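(* Let $G$ be a triangle-free graph of order $n$ with minimum degree $\delta(G)\geq 2$ and maximum degree $\Delta(G)$. Then $$\gamma_{2}^{oi}(G)\leq\frac{\Delta(G)+1}{\Delta(G)+3}\,n.$$
   Context: All graphs are finite and simple. A $2$-outer-independent dominating set ($2$OID set) of a graph $G$ is a set $S\subseteq V(G)$ such that every vertex of $V(G)\setminus S$ has at least two neighbors in $S$ and $V(G)\setminus S$ is an independent set. The $2$OID number $\gamma_{2}^{oi}(G)$ is the smallest cardinality of a $2$OID set of $G$. *)

(* Defs.v *)
From mathcomp Require Import all_boot all_order all_algebra.

Set Implicit Arguments.
Unset Strict Implicit.
Unset Printing Implicit Defensive.

(* A finite simple graph is a symmetric irreflexive relation on a finType. *)
Definition simple_graph (T : finType) (e : rel T) : Prop :=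
  symmetric e /\ irreflexive e.

Definition neighbors (T : finType) (e : rel T) (x : T) : {set T} :=
  [set y | e x y].

Definition degree (T : finType) (e : rel T) (x : T) : nat := #|neighbors e x|.

(* Degrees never exceed #|T|, so the default value #|T| does not affect the
   minimum over a nonempty T; on the empty graph min_degree is 0. *)
Definition min_degree (T : finType) (e : rel T) : nat :=
  \big[minn/#|T|]_(x : T) degree e x.

Definition max_degree (T : finType) (e : rel T) : nat :=
  \max_(x : T) degree e x.

Definition triangle_free (T : finType) (e : rel T) : Prop :=
  forall x y z : T, ~~ [&& e x y, e y z & e x z].

Definition independent (T : finType) (e : rel T) (A : {set T}) : bool :=
  [forall x in A, forall y in A, ~~ e x y].

Definition oid2_set (T : finType) (e : rel T) (S : {set T}) : bool :=
  [forall x in ~: S, 2 <= #|neighbors e x :&: S|] && independent e (~: S).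

(* [set: T] is always a 2OID set (oid2_setT), so the arg min is a 2OID set of
   least cardinality. *)
Definition oid2_number (T : finType) (e : rel T) : nat :=
  #|[arg min_(S < [set: T] | oid2_set e S) #|S|]|.

Lemma oid2_setT (T : finType) (e : rel T) : oid2_set e [set: T].
Proof.
rewrite /oid2_set /independent setCT; apply/andP; split.
  by apply/forallP=> x; rewrite inE.
by apply/forallP=> x; rewrite inE.
Qed.

Lemma oid2_numberP (T : finType) (e : rel T) :
  (exists2 S, oid2_set e S & #|S| = oid2_number e) /\
  (forall S, oid2_set e S -> oid2_number e <= #|S|).
Proof.
rewrite /oid2_number; case: arg_minnP => [|S eS leS]; first exact: oid2_setT.
by split; [exists S | exact: leS].
Qed.

Lemma min_degreeP (T : finType) (e : rel T) (k : nat) : 0 < #|T| ->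
  (k <= min_degree e) <-> (forall x, k <= degree e x).
Proof.
case/card_gt0P=> x0 _; rewrite /min_degree; split=> [le_k x | le_k].
  have: x \in index_enum T by rewrite mem_index_enum.
  elim: (index_enum T) le_k => [//|y s IHs]; rewrite big_cons leq_min.
  by case/andP=> le_y /IHs le_s; rewrite inE => /predU1P[->|/le_s].
elim/big_ind: _ => [|m n lem len|//]; last by rewrite leq_min lem len.
exact: leq_trans (le_k x0) (max_card _).
Qed.

(* Main.v *)
Require Import Defs.
From mathcomp Require Import all_boot all_order all_algebra.
From mathcomp Require Import ring lra.

(** When every degree is at least 2, the complement of an independent set [I] is
    a 2OID set: a vertex of [I] has all of its neighbors, hence at least two of
    them, outside [I] (lemma [oid2_set_setC]).  The theorem thus reduces to an
    independent set of size at least [2 n / (Delta + 3)].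

    Such a set comes from Shearer's argument for triangle-free graphs: some
    independent set has at least [\sum_x w (d x)] vertices, where
    [w d = 2 / (d + 3)] and [d x] is the degree of [x]
    ([weight_le_independent]).  Pick a vertex [v], delete [v] and its neighbors,
    and apply induction to the graph that remains.  This works for [v] as soon
    as its gain, which is 1 plus the total weight of the remaining graph minus
    the total weight of the whole graph, is nonnegative; so it suffices that the
    gains have a nonnegative sum ([ex_far_weight_gain]).

    Deleting the closed neighborhood of [v] lowers the degree of a remaining
    vertex [x] by the number of common neighbors of [x] and [v].  As [w] is
    convex, the weight of [x] rises by at least that number times
    [g (d x)], where [g d = w (d - 1) - w d].  Since there are no triangles, a
    neighbor of [v] has no common neighbor with [v], and the sum over all [v]
    and [x] of these increases counts the walks of length 2 from [x] to [v],
    which gives [g (d x) * d u] for each ordered adjacent pair [(x, u)]; the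
    closed walks among them, those with [x = v], are subtracted separately.
    As [g] is decreasing, the rearrangement inequality bounds
    [g (d x) * d u + g (d u) * d x] below by
    [g (d x) * d x + g (d u) * d u].  The sum of the gains is then at least a
    sum of terms that depend on one degree [d] each, and such a term equals
    [(d - 1) (d - 2) / ((d + 2) (d + 3))], which is nonnegative for integral
    [d]. *)

Set Implicit Arguments.
Unset Strict Implicit.
Unset Printing Implicit Defensive.

Import Order.TTheory GRing.Theory Num.Theory.

Local Open Scope ring_scope.

(** * The weight of a degree *)

Definition weight (d : rat) : rat := 2 / (d + 3).

(** This is [weight (d - 1) - weight d] in closed form. *)
Definition decrement (d : rat) : rat := 2 / ((d + 2) * (d + 3)).

(** Convexity of [weight]: moving left from [d] by an integer number of unit
    steps gains at least [decrement d] per step.  The inequality fails for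
    fractional steps between 0 and 1, hence the type of [k]. *)
Lemma weight_chord (d : rat) (k : nat) :
  k%:R <= d -> weight d + k%:R * decrement d <= weight (d - k%:R).
Proof.
rewrite /weight /decrement.
case: k => [_|k]; first by rewrite mul0r addr0 subr0.
move=> le_kd; have k_ge1 : 1 <= k.+1%:R :> rat by rewrite ler1n.
set c : rat := k.+1%:R in le_kd k_ge1 *.
have -> : 2 / (d - c + 3) = 2 / (d + 3) + c * (2 / ((d - c + 3) * (d + 3))).
  by field; apply/andP; split; apply: lt0r_neq0; lra.
have lt_prod : 0 < (d - c + 3) * (d + 3) by rewrite mulr_gt0 //; lra.
have lt_prod2 : 0 < (d + 2) * (d + 3) by rewrite mulr_gt0 //; lra.
rewrite lerD2l ler_wpM2l ?ler_wpM2l ?lef_pV2 ?posrE ?ler_pM2r //; lra.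
Qed.

Lemma decrement_antitone (c d : rat) :
  0 <= c -> c <= d -> decrement d <= decrement c.
Proof. by move=> c_ge0 le_cd; rewrite ler_wpM2l // lef_pV2 ?posrE; nra. Qed.

(** Rearrangement inequality for a decreasing function: pairing the larger value
    of [decrement] with the larger argument increases the sum. *)
Lemma decrement_rearrangement (c d : rat) : 0 <= c -> 0 <= d ->
  decrement c * c + decrement d * d <= decrement c * d + decrement d * c.
Proof.
wlog le_cd : c d / c <= d => [wlog_cd c0 d0|c0 d0].
  case/orP: (le_total c d) => /wlog_cd; first exact.
  by rewrite addrC (addrC (decrement c * d)); apply.
by have := decrement_antitone c0 le_cd; nra.
Qed.

(** The contribution of a vertex of degree [d] to the sum of the gains, once the
    rearrangement inequality has removed the degrees of its neighbors.  It is
    zero for [d = 1] and [d = 2], and negative between these two values, so the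
    integrality of [d] matters. *)
Lemma weight_local_gain (d : nat) :
  0 <= 1 - weight d%:R - d%:R * weight d%:R
       + d%:R ^+ 2 * decrement d%:R - d%:R * decrement d%:R.
Proof.
rewrite /weight /decrement; have d_ge0 : 0 <= d%:R :> rat by [].
have root12 : 0 <= (d%:R - 1) * (d%:R - 2) :> rat.
  case: d {d_ge0} => [|[|d]]; [lra | by rewrite subrr mul0r |].
  by rewrite mulr_ge0 // subr_ge0 ?ler1n ?ler_nat.
set c : rat := d%:R in d_ge0 root12 *.
have -> : 1 - 2 / (c + 3) - c * (2 / (c + 3))
    + c ^+ 2 * (2 / ((c + 2) * (c + 3))) - c * (2 / ((c + 2) * (c + 3)))
  = (c - 1) * (c - 2) / ((c + 2) * (c + 3)).
  by field; apply/andP; split; apply: lt0r_neq0; lra.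
by rewrite divr_ge0 //; nra.
Qed.

(** * Deleting a closed neighborhood *)

Section InducedSubgraph.

Variables (T : finType) (e : rel T).
Hypotheses (sym_e : symmetric e) (irr_e : irreflexive e).
Hypothesis tf_e : triangle_free e.

Implicit Types (A : {set T}) (u v x : T).

Definition degree_in A x : nat := #|neighbors e x :&: A|.

Definition codegree_in A x v : nat :=
  #|neighbors e x :&: neighbors e v :&: A|.

Definition far_from A v : {set T} := A :\: (v |: neighbors e v).

Local Notation adj x u := ((e x u)%:R : rat).
Local Notation deg A x := ((degree_in A x)%:R : rat).

Lemma degree_in_sum A x : deg A x = \sum_(u in A) adj x u.
Proof.
rewrite /degree_in -sum1_card natr_sum big_mkcond [RHS]big_mkcond /=.
by apply: eq_bigr => u _; rewrite !inE andbC; case: (u \in A); case: (e x u).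
Qed.

Lemma codegree_in_sum A x v :
  (codegree_in A x v)%:R = \sum_(u in A) adj x u * adj v u.
Proof.
rewrite /codegree_in -sum1_card natr_sum big_mkcond [RHS]big_mkcond /=.
apply: eq_bigr => u _; rewrite !inE.
by case: (u \in A); case: (e x u); case: (e v u);
  rewrite /= ?mulr1 ?mulr0 ?mul0r.
Qed.

Lemma codegree_in_id A v : codegree_in A v v = degree_in A v.
Proof. by rewrite /codegree_in setIid. Qed.

(** A common neighbor of two adjacent vertices would close a triangle. *)
Lemma codegree_in_adj A x v : e x v -> codegree_in A x v = 0%N.
Proof.
move=> xv; apply/eqP; rewrite cards_eq0; apply/eqP/setP=> u; rewrite !inE.
apply: contraNF (tf_e x v u) => /andP[/andP[xu vu] _].
by rewrite xv xu vu.
Qed.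

Lemma degree_in_far A v x : x \in far_from A v ->
  degree_in (far_from A v) x = (degree_in A x - codegree_in A x v)%N.
Proof.
rewrite !inE negb_or => /andP[/andP[x_neq_v vNx] xA].
rewrite /degree_in /codegree_in -cardsDS; last first.
  by apply/subsetP=> u; rewrite !inE => /andP[/andP[-> _] ->].
apply: eq_card => u; rewrite !inE.
have [->|_] := eqVneq u v; first by rewrite sym_e (negPf vNx) ?andbF.
by case: (e x u); case: (e v u); case: (u \in A).
Qed.

Lemma weight_far A v x : x \in far_from A v ->
  weight (deg A x) + (codegree_in A x v)%:R * decrement (deg A x)
    <= weight (deg (far_from A v) x).
Proof.
move=> xB; have le_codeg : (codegree_in A x v <= degree_in A x)%N.
  by rewrite subset_leq_card // setSI // subsetIl.
by rewrite degree_in_far // natrB // weight_chord // ler_nat.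
Qed.

(** [A] splits into [v], the neighbors of [v] and the vertices far from [v];
    the middle part is summed against adjacency indicators so that it can be
    double counted over [v] afterwards. *)
Lemma big_far A v (F : T -> rat) : v \in A ->
  \sum_(x in A) F x =
    F v + \sum_(x in A) adj v x * F x + \sum_(x in far_from A v) F x.
Proof.
move=> vA; rewrite (bigD1 v) //= -addrA; congr (_ + _).
rewrite (big_mkcond (fun x => (x \in A) && _)).
rewrite [X in X + _]big_mkcond [X in _ + X]big_mkcond -big_split /=.
apply: eq_bigr => x _; rewrite !inE.
have [->|_] := eqVneq x v.
  by rewrite irr_e mul0r if_same !addr0 ?andbF ?eqxx.
by case: (x \in A); case: (e v x); rewrite /= ?mul1r ?mul0r ?addr0 ?add0r.
Qed.

(** The sum of codegrees ranges over all of [A], which makes it easy to average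
    over [v].  Among the extra terms, those of the neighbors of [v] vanish, and
    the one of [v] itself is the last term subtracted on the left. *)
Lemma far_weight_gain A v : v \in A ->
  1 - weight (deg A v) - \sum_(x in A) adj v x * weight (deg A x)
    + \sum_(x in A) (codegree_in A x v)%:R * decrement (deg A x)
    - deg A v * decrement (deg A v)
  <= 1 + \sum_(x in far_from A v) weight (deg (far_from A v) x)
     - \sum_(x in A) weight (deg A x).
Proof.
move=> vA; rewrite (big_far (fun x => weight _) vA).
rewrite (big_far (fun x => _ * decrement _) vA) codegree_in_id.
have -> : \sum_(x in A)
    adj v x * ((codegree_in A x v)%:R * decrement (deg A x)) = 0.
  apply: big1 => x _; case vx: (e v x); last by rewrite mul0r.
  by rewrite codegree_in_adj ?mul0r ?mulr0 // sym_e.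
have : \sum_(x in far_from A v)
      (weight (deg A x) + (codegree_in A x v)%:R * decrement (deg A x))
    <= \sum_(x in far_from A v) weight (deg (far_from A v) x).
  by apply: ler_sum => x; apply: weight_far.
by rewrite big_split /=; lra.
Qed.

(** * Averaging over the deleted vertex *)

Lemma sum_neighbor_weight A (F : T -> rat) :
  \sum_(v in A) \sum_(x in A) adj v x * F x = \sum_(x in A) deg A x * F x.
Proof.
rewrite exchange_big; apply: eq_bigr => x _ /=.
by rewrite -mulr_suml degree_in_sum; under eq_bigr do rewrite sym_e.
Qed.

(** Both sides count the walks of length 2 in [A] that start at [x]. *)
Lemma sum_codegree A x :
  \sum_(v in A) (codegree_in A x v)%:R = \sum_(u in A) adj x u * deg A u.
Proof.
under eq_bigr do rewrite codegree_in_sum.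
rewrite exchange_big; apply: eq_bigr => u _ /=.
by rewrite -mulr_sumr degree_in_sum; under eq_bigr do rewrite sym_e.
Qed.

(** The right-hand side is the sum of [decrement (deg x) * deg u] over ordered
    adjacent pairs [(x, u)]; adding the contributions of [(x, u)] and [(u, x)]
    gives the pattern of the rearrangement inequality. *)
Lemma sum_codegree_decrement A :
  \sum_(x in A) deg A x ^+ 2 * decrement (deg A x) <=
  \sum_(v in A) \sum_(x in A) (codegree_in A x v)%:R * decrement (deg A x).
Proof.
rewrite exchange_big /=; under [leRHS]eq_bigr do
  rewrite -mulr_suml sum_codegree mulr_suml.
pose h x u : rat := adj x u * (decrement (deg A x) * deg A u).
pose g x u : rat := adj x u * (decrement (deg A x) * deg A x).
have -> : \sum_(x in A) deg A x ^+ 2 * decrement (deg A x)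
    = \sum_(x in A) \sum_(u in A) g x u.
  apply: eq_bigr => x _; rewrite /g -mulr_suml -degree_in_sum; ring.
have -> : \sum_(x in A) \sum_(u in A) adj x u * deg A u * decrement (deg A x)
    = \sum_(x in A) \sum_(u in A) h x u.
  by apply: eq_bigr => x _; apply: eq_bigr => u _; rewrite /h; ring.
have swap (F : T -> T -> rat) : 2 * \sum_(x in A) \sum_(u in A) F x u
    = \sum_(x in A) \sum_(u in A) (F x u + F u x).
  under [RHS]eq_bigr do rewrite big_split /=.
  by rewrite big_split /= [X in _ + X]exchange_big /=; ring.
rewrite -(ler_pM2l (_ : 0 < 2 :> rat)) // !swap.
apply: ler_sum => x _; apply: ler_sum => u _.
rewrite /g /h (sym_e u) -!mulrDr ler_wpM2l //.
exact: decrement_rearrangement.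
Qed.

(** The sum of the gains over [v] is at least the sum of the local gains, so not
    every gain is negative. *)
Lemma ex_far_weight_gain A : A != set0 ->
  exists2 v, v \in A & \sum_(x in A) weight (deg A x)
    <= 1 + \sum_(x in far_from A v) weight (deg (far_from A v) x).
Proof.
case/set0Pn=> a aA.
pose gain v := 1 + \sum_(x in far_from A v) weight (deg (far_from A v) x)
  - \sum_(x in A) weight (deg A x).
case: (boolP [exists v in A, 0 <= gain v]) => [/exists_inP[v vA]|].
  by rewrite subr_ge0; exists v.
move/exists_inPn=> gain_lt0.
have : \sum_(v in A) gain v < 0.
  rewrite (bigD1 a) //=; have := gain_lt0 a aA; rewrite -ltNge => gain_a.
  rewrite -[ltRHS]addr0 ltr_leD // sumr_le0 // => v /andP[/gain_lt0 + _].
  by rewrite -ltNge => /ltW.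
rewrite ltNge; case/negP.
apply: le_trans (ler_sum _ (fun v => @far_weight_gain A v)).
rewrite sumrB big_split /= !sumrB sum_neighbor_weight.
have := sum_codegree_decrement A.
have : 0 <= \sum_(x in A) (1 - weight (deg A x) - deg A x * weight (deg A x)
    + deg A x ^+ 2 * decrement (deg A x) - deg A x * decrement (deg A x)).
  apply: sumr_ge0 => x _; apply: weight_local_gain.
by rewrite sumrB big_split /= !sumrB; lra.
Qed.

(** Shearer's bound: prepend [v] to an independent set obtained by induction
    among the vertices far from [v]. *)
Lemma weight_le_independent A :
  exists2 I : {set T}, (I \subset A) && independent e I
    & \sum_(x in A) weight (deg A x) <= #|I|%:R.
Proof.
have [m] := ubnP #|A|; elim: m A => // m IHm A /ltnSE le_Am.
have [->|A_neq0] := eqVneq A set0.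
  exists set0; last by rewrite big_set0 cards0.
  by rewrite sub0set; apply/forall_inP=> x; rewrite inE.
have [v vA le_gain] := ex_far_weight_gain A_neq0.
have BA : far_from A v \proper A.
  by apply/properP; split; [apply: subsetDl | exists v; rewrite // !inE eqxx].
have [I /andP[IB indI] le_I] := IHm _ (leq_trans (proper_card BA) le_Am).
have farI x : x \in I -> ((x != v) && ~~ e v x) && (x \in A).
  by move/(subsetP IB); rewrite !inE negb_or.
have vNI : v \notin I by apply/negP=> /farI; rewrite eqxx.
exists (v |: I); last first.
  by rewrite cardsU1 vNI natrD (le_trans le_gain) ?lerD2l.
apply/andP; split.
  by apply/subsetP=> x /setU1P[-> //|/farI/andP[]].
apply/forall_inP=> x /setU1P[->|xI]; apply/forall_inP=> y /setU1P[->|yI].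
- by rewrite irr_e.
- by have /andP[/andP[]] := farI y yI.
- by rewrite sym_e; have /andP[/andP[]] := farI x xI.
- by have /forall_inP/(_ x xI)/forall_inP/(_ y yI) := indI.
Qed.

End InducedSubgraph.

(** * From independent sets to 2OID sets *)

Lemma oid2_set_setC (T : finType) (e : rel T) (I : {set T}) :
  (2 <= min_degree e)%N -> independent e I -> oid2_set e (~: I).
Proof.
move=> mindeg_ge2 indI; rewrite /oid2_set setCK indI andbT.
apply/forall_inP=> x xI.
have T_gt0 : (0 < #|T|)%N by apply/card_gt0P; exists x.
have -> : neighbors e x :&: ~: I = neighbors e x.
  apply/setIidPl/subsetP=> y; rewrite !inE; apply: contraL => yI.
  by have /forall_inP/(_ x xI)/forall_inP/(_ y yI) := indI.
by have /(min_degreeP _ _ T_gt0)/(_ x) := mindeg_ge2.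
Qed.

Theorem theorem4p5 (T : finType) (e : rel T) (n : nat)
    (graph_e : simple_graph e) (order_n : #|T| = n)
    (tf_e : triangle_free e) (mindeg_ge2 : (2 <= min_degree e)%N) :
  (oid2_number e)%:R
    <= ((max_degree e)%:R + 1) / ((max_degree e)%:R + 3) * n%:R :> rat.
Proof.
case: graph_e => sym_e irr_e.
have [I /andP[_ indI] weight_le_I] :=
  weight_le_independent sym_e irr_e tf_e [set: T].
set D : rat := (max_degree e)%:R.
have D_ge0 : 0 <= D by rewrite /D.
have le_weight : n%:R * weight D <= #|I|%:R :> rat.
  apply: le_trans weight_le_I.
  rewrite -order_n -cardsT mulr_natl -sumr_const; apply: ler_sum => x _.
  rewrite /weight /degree_in setIT ler_wpM2l // lef_pV2 ?posrE ?lerD2r.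
  - by rewrite ler_nat (leq_bigmax x).
  - by rewrite ltr_wpDl.
  - by rewrite ltr_wpDl.
have le_oid : (oid2_number e)%:R <= n%:R - #|I|%:R :> rat.
  rewrite lerBrDr -natrD ler_nat -order_n -(cardsC I) addnC leq_add2l.
  by have [_] := oid2_numberP e; apply; apply: oid2_set_setC.
have -> : (D + 1) / (D + 3) * n%:R = n%:R - n%:R * weight D.
  by rewrite /weight; field; apply: lt0r_neq0; lra.
by rewrite (le_trans le_oid) // lerD2l lerN2.
Qed.
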